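(* Let $X = \langle x_1,\ldots,x_n\rangle$ and $Y = \langle y_1,\ldots,y_m\rangle$ be sequences over an alphabet $\Sigma$, and let $P = \langle p_1,\ldots,p_r\rangle$ be a common subsequence of $X$ and $Y$. Consider the constrained sequence alignment (CSA) problem for $X$, $Y$, $P$ with the distance function $\delta$ on $\Sigma \cup \{\texttt{-}\}$ given by $\delta(x',y') = -1$ if $x' = y'$ and $\delta(x',y') = 0$ if $x' \neq y'$. Then the CLCS problem for $X$ and $Y$ with respect to $P$ is equivalent to this CSA problem, in the following sense: for every optimal (minimum-score) constrained alignment $\left[{X' \atop Y'}\right]$, the sequence $Z'$ formed by the characters of the columns $i$ with $x'_i = y'_i$ (in order) is a constrained longest common subsequence of $X$ and $Y$ with respect to $P$; and conversely, for every constrained longest common subsequence $Z$ of $X$ and $Y$ with respect to $P$, of length $\ell$, inserting spaces into $X$ and $Y$ so that each character of $Z$ occupies a common column yields an optimal constrained alignment, whose score is $-\ell$.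
   Context: A subsequence of a sequence $X$ is obtained by deleting some (not necessarily contiguous) characters; a common subsequence of $X$ and $Y$ is a subsequence of both. A constrained longest common subsequence (CLCS) of $X$ and $Y$ with respect to $P$ is a longest common subsequence $Z$ of $X$ and $Y$ such that $P$ is a subsequence of $Z$. An alignment of $X$ (length $n$) and $Y$ (length $m$) is a pair of sequences $X' = \langle x'_1,\ldots,x'_{n'}\rangle$, $Y' = \langle y'_1,\ldots,y'_{n'}\rangle$ over $\Sigma \cup \{\texttt{-}\}$ (where $\texttt{-}\notin\Sigma$ is the space character) of equal length $n' \ge n, m$ such that removing all spaces from $X'$ and $Y'$ gives $X$ and $Y$ respectively, and there is no $i$ with $x'_i = y'_i = \texttt{-}$. Its score under a distance function $\delta : (\Sigma\cup\{\texttt{-}\})^2 \to \mathbb{R}$ is $\sum_{i=1}^{n'} \delta(x'_i, y'_i)$. Given a constrained sequence $P = \langle p_1,\ldots,p_r\rangle$ that is a common subsequence of $X$ and $Y$, a constrained alignment is an alignment for which there exist indices $1 \le c_1 < c_2 < \cdots < c_r \le n'$ with $x'_{c_k} = y'_{c_k} = p_k$ for all $1 \le k \le r$. The CSA problem asks for a constrained alignment of minimum score. *)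

(* Defs.v *)
From mathcomp Require Import all_boot all_order all_algebra.
From mathcomp Require Import reals.

Set Implicit Arguments.
Unset Strict Implicit.
Unset Printing Implicit Defensive.

Import Order.TTheory GRing.Theory Num.Theory.
Local Open Scope ring_scope.

Definition common_subseq (T : eqType) (X Y Z : seq T) : Prop :=
  subseq Z X /\ subseq Z Y.

(* Length is maximal among the common subsequences that contain P, not among
   all common subsequences. *)
Definition is_CLCS (T : eqType) (X Y P Z : seq T) : Prop :=
  [/\ common_subseq X Y Z, subseq P Z &
      forall W : seq T,
        common_subseq X Y W -> subseq P W -> (size W <= size Z)%N].

(* Gapped sequences are over [option T]: [Some a] is the character a, [None]
   is the space, and [pmap id] removes the spaces. *)
Definition is_alignment (T : eqType) (X Y : seq T) (X' Y' : seq (option T))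
  : Prop :=
  [/\ size X' = size Y', pmap id X' = X, pmap id Y' = Y &
      ~ exists i : 'I_(size X'), nth None X' i = None /\ nth None Y' i = None].

Definition score (T : eqType) (R : realType)
    (delta : option T -> option T -> R) (X' Y' : seq (option T)) : R :=
  \sum_(i < size X') delta (nth None X' i) (nth None Y' i).

Definition occupies_columns (T : eqType) (P : seq T) (X' Y' : seq (option T))
  : Prop :=
  exists c : 'I_(size P) -> 'I_(size X'),
    (forall k l : 'I_(size P), (k < l)%N -> (c k < c l)%N) /\
    (forall k : 'I_(size P),
        nth None X' (c k) = Some (tnth (in_tuple P) k) /\
        nth None Y' (c k) = Some (tnth (in_tuple P) k)).

Definition is_constrained_alignment (T : eqType) (X Y P : seq T)
    (X' Y' : seq (option T)) : Prop :=
  is_alignment X Y X' Y' /\ occupies_columns P X' Y'.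

Definition is_optimal_CSA (T : eqType) (R : realType)
    (delta : option T -> option T -> R) (X Y P : seq T)
    (X' Y' : seq (option T)) : Prop :=
  is_constrained_alignment X Y P X' Y' /\
  forall U V : seq (option T),
    is_constrained_alignment X Y P U V -> score delta X' Y' <= score delta U V.

Definition match_delta (T : eqType) (R : realType) (x y : option T) : R :=
  if x == y then -1 else 0.

(* [pmap] drops no column when X', Y' is an alignment, since then no two equal
   entries are both [None]. *)
Definition matched_seq (T : eqType) (X' Y' : seq (option T)) : seq T :=
  pmap fst [seq u <- zip X' Y' | u.1 == u.2].

(* Main.v *)
(** The score of an alignment is minus the length of its matched sequence, the
    matched sequence is a common subsequence of X and Y, and a sequence occupies
    columns of an alignment exactly when it is a subsequence of the matched
    sequence.  As every common subsequence occupies columns of some alignment,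
    minimising the score over constrained alignments is maximising the length
    over common subsequences that contain P. *)
Require Import Defs.
From mathcomp Require Import all_boot all_order all_algebra.
From mathcomp Require Import reals.

Set Implicit Arguments.
Unset Strict Implicit.
Unset Printing Implicit Defensive.

Import Order.TTheory GRing.Theory Num.Theory.
Local Open Scope ring_scope.

(** Brings the index maps of [occupies_columns] under the theory of [subseq]: the values of a
    strictly increasing map form a subsequence of [iota 0 (size t)], and mapping [nth x0 t] over
    that list gives back [t]. *)
Lemma subseq_ordP (T : eqType) (x0 : T) (s t : seq T) :
  (exists c : 'I_(size s) -> 'I_(size t),
      (forall k l : 'I_(size s), (k < l)%N -> (c k < c l)%N) /\
      (forall k : 'I_(size s), nth x0 t (c k) = nth x0 s k))
  <-> subseq s t.
Proof.
split=> [[c [c_mono c_nth]] | /subseqP [m size_m ->]].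
  pose js := [seq val (c k) | k <- enum 'I_(size s)].
  have js_sorted : sorted ltn js.
    apply: (homo_sorted (e := relpre val ltn) c_mono).
    by rewrite -sorted_map val_enum_ord iota_ltn_sorted.
  have js_iota : subseq js (iota 0 (size t)).
    (* A subsequence of a duplicate-free list is its filter by membership, and strictly sorted lists
       with the same members are equal. *)
    apply/(subseq_uniqP (iota_uniq _ _)).
    apply: (irr_sorted_eq ltn_trans ltnn js_sorted).
      exact/(sorted_filter ltn_trans)/iota_ltn_sorted.
    move=> j; rewrite mem_filter mem_iota /=.
    by case: (boolP (j \in js)) => // /mapP [k _ ->]; rewrite add0n ltn_ord.
  have := map_subseq (nth x0 t) js_iota.
  rewrite map_nth_iota0 // take_size -map_comp; congr (subseq _ _).
  rewrite (eq_map (g := nth x0 s \o val)) // map_comp val_enum_ord.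
  by rewrite map_nth_iota0 // take_size.
(* Masking the indices instead of the entries recovers the positions that [m] keeps. *)
pose js := mask m (iota 0 (size t)).
have mask_js : mask m t = [seq nth x0 t j | j <- js].
  by rewrite map_mask map_nth_iota0 // take_size.
have js_sorted : sorted ltn js.
  exact: (subseq_sorted ltn_trans (mask_subseq _ _)) (iota_ltn_sorted _ _).
have size_js : size (mask m t) = size js by rewrite mask_js size_map.
have js_lt (k : 'I_(size (mask m t))) : (nth 0%N js k < size t)%N.
  have : nth 0%N js k \in iota 0 (size t).
    by apply/(mem_subseq (mask_subseq m _))/mem_nth; rewrite -size_js ltn_ord.
  by rewrite mem_iota add0n.
exists (fun k => Ordinal (js_lt k)); split=> [k l lt_kl | k] /=.
  by apply: (sorted_ltn_nth ltn_trans) => //; rewrite inE -size_js ltn_ord.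
by rewrite {2}mask_js (nth_map 0%N) // -size_js ltn_ord.
Qed.

Lemma pmap_subseq (aT rT : eqType) (f : aT -> option rT) (s t : seq aT) :
  subseq s t -> subseq (pmap f s) (pmap f t).
Proof.
case/subseqP=> m _ ->; elim: m t => [|b m IHm] [|x t]; rewrite ?sub0seq //.
case: b => /=; case: (f x) => [y|] /=; rewrite ?eqxx //.
exact: subseq_trans (IHm t) (subseq_cons _ _).
Qed.

Lemma pmap_map (A B C : Type) (f : A -> B) (g : B -> option C) (s : seq A) :
  pmap g (map f s) = pmap (g \o f) s.
Proof. by elim: s => //= x s ->. Qed.

Section Columns.
Variable T : eqType.

Definition match_col (a : T) : option T * option T := (Some a, Some a).

Lemma occupies_columns_zip Z X' Y' : size X' = size Y' ->
  occupies_columns Z X' Y' <-> subseq (map match_col Z) (zip X' Y').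
Proof.
move=> szE; rewrite -(subseq_ordP (None, None)) /occupies_columns.
rewrite size_map size1_zip ?szE //.
split=> -[c [c_mono c_nth]]; exists c; split=> // k; have := c_nth k;
  (* [T] may be empty, so the default for [nth] is taken from [Z], which is nonempty because [k]
     indexes it. *)
  have z0 := tnth (in_tuple Z) k;
  rewrite nth_zip // (nth_map z0) // (tnth_nth z0) => -[-> ->] //.
Qed.

Lemma map_matched_seq (X Y : seq T) X' Y' :
  is_alignment X Y X' Y' ->
  [seq match_col a | a <- matched_seq X' Y'] =
  [seq u <- zip X' Y' | u.1 == u.2].
Proof.
case=> szE _ _ nogap; rewrite /matched_seq.
have : (None, None) \notin zip X' Y'.
  apply/negP=> /(nthP (None, None)) [i].
  rewrite size1_zip ?szE // nth_zip // => lt_i [xi yi]; case: nogap.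
  by rewrite -szE in lt_i; exists (Ordinal lt_i).
elim: (zip X' Y') => //= -[[a|] [b|]] s IHs; rewrite inE //= => /IHs //.
by case: eqP => //= -[->] ->.
Qed.

Lemma size_matched_seq (X Y : seq T) X' Y' :
  is_alignment X Y X' Y' ->
  size (matched_seq X' Y') = count (fun u => u.1 == u.2) (zip X' Y').
Proof.
by move=> al; rewrite -size_filter -(map_matched_seq al) size_map.
Qed.

(** Columns [match_col a] have equal entries, so filtering the alignment to its equal columns loses
    none of them; [pmap fst] undoes [match_col] and so carries subsequences of columns back to
    characters. *)
Lemma occupies_columns_matched (X Y Z : seq T) X' Y' :
  is_alignment X Y X' Y' ->
  occupies_columns Z X' Y' <-> subseq Z (matched_seq X' Y').
Proof.
move=> al; have [szE _ _ _] := al; rewrite occupies_columns_zip //.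
have -> : subseq (map match_col Z) (zip X' Y') =
          subseq (map match_col Z) (map match_col (matched_seq X' Y')).
  rewrite (map_matched_seq al) subseq_filter.
  by rewrite all_map (eq_all (a2 := predT)) ?all_predT // => a /=; rewrite eqxx.
split=> [/(pmap_subseq fst)|]; last exact: map_subseq.
have colK W : pmap fst (map match_col W) = W by elim: W => //= a W ->.
by rewrite !colK.
Qed.

Lemma matched_seq_common (X Y : seq T) X' Y' :
  is_alignment X Y X' Y' ->
  common_subseq X Y (matched_seq X' Y').
Proof.
case=> szE <- <- _.
have colsX : X' = unzip1 (zip X' Y') by rewrite unzip1_zip ?szE.
have colsY : Y' = unzip2 (zip X' Y') by rewrite unzip2_zip ?szE.
split.
  by rewrite {2}colsX pmap_map; apply/pmap_subseq/filter_subseq.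
rewrite {2}colsY pmap_map /matched_seq.
(* On columns with equal entries both projections agree, so the argument for [X] carries over to
   [Y]. *)
have -> : pmap fst [seq u <- zip X' Y' | u.1 == u.2] =
          pmap snd [seq u <- zip X' Y' | u.1 == u.2].
  by elim: (zip X' Y') => //= -[x y] s IHs /=; case: eqP => //= ->; rewrite IHs.
exact/pmap_subseq/filter_subseq.
Qed.

(** Greedy construction by induction on [X]: a character of [X] that is not the next one of [Z]
    faces a space; otherwise it is matched with its first occurrence in the rest of [Y]. *)
Lemma common_subseq_columns (X Y Z : seq T) : common_subseq X Y Z ->
  exists s : seq (option T * option T),
    [/\ pmap fst s = X, pmap snd s = Y, (None, None) \notin s &
        subseq (map match_col Z) s].
Proof.
case; elim: X Y Z => [|x X IHX] Y Z.
  rewrite subseq0 => /eqP -> _; exists [seq (None, Some y) | y <- Y].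
  by split; rewrite ?sub0seq //; elim: Y => //= y Y ->.
have skip_x Y0 Z0 : subseq Z0 X -> subseq Z0 Y0 ->
    exists s : seq (option T * option T),
      [/\ pmap fst s = x :: X, pmap snd s = Y0, (None, None) \notin s &
          subseq (map match_col Z0) s].
  move=> ZX ZY; have [s [<- <- nogap sub]] := IHX _ _ ZX ZY.
  exists ((Some x, None) :: s); split; rewrite ?inE //=.
  exact: subseq_trans sub (subseq_cons _ _).
case: Z => [|z Z]; first by move=> _ _; apply: skip_x; exact: sub0seq.
have [-> | /negPf neq_zx] := eqVneq z x; last first.
  by move=> /=; rewrite neq_zx => sub_x; exact: (skip_x Y (z :: Z)).
(* The inner induction scans [Y] for [x], setting each character passed over against a space. *)
rewrite /= eqxx => sub_x; elim: Y {skip_x} => [|y Y IHY] //=.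
case: eqP => [<- | _] sub_y.
  have [s [<- <- nogap sub]] := IHX _ _ sub_x sub_y.
  by exists (match_col x :: s); split; rewrite ?inE //= eqxx.
have [s [eX eY nogap sub]] := IHY sub_y.
exists ((None, Some y) :: s); split; rewrite ?inE //= ?eY //.
Qed.

Lemma common_subseq_alignment (X Y Z : seq T) : common_subseq X Y Z ->
  exists X' Y', is_alignment X Y X' Y' /\ occupies_columns Z X' Y'.
Proof.
case/common_subseq_columns=> s [sX sY nogap sub].
have szE : size (unzip1 s) = size (unzip2 s) by rewrite !size_map.
exists (unzip1 s), (unzip2 s); split; last first.
  by rewrite occupies_columns_zip // zip_unzip.
split; rewrite ?pmap_map // => -[i [xi yi]]; move/negP: nogap; apply.
have <- : nth (None, None) (zip (unzip1 s) (unzip2 s)) i = (None, None).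
  by rewrite nth_zip // xi yi.
by rewrite zip_unzip mem_nth // -(size_map fst s) ltn_ord.
Qed.

Lemma score_match_delta (R : realType) (X Y : seq T) X' Y' :
  is_alignment X Y X' Y' ->
  score (@match_delta T R) X' Y' = - (size (matched_seq X' Y'))%:R.
Proof.
move=> al; have [szE _ _ _] := al.
rewrite (size_matched_seq al) -sum1_count natr_sum -sumrN.
rewrite (big_nth (None, None)) big_mkord size1_zip ?szE // -szE big_mkcond.
by apply: eq_bigr => i _; rewrite nth_zip.
Qed.

End Columns.

(** Spaces can be inserted along [Z] in several ways, so the converse speaks of all of them; the
    existence clause keeps it from being vacuous. *)
Theorem theorem3 (R : realType) (T : eqType) (X Y P : seq T)
    (hP : common_subseq X Y P) :
  (forall X' Y' : seq (option T),
      is_optimal_CSA (@match_delta T R) X Y P X' Y' ->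
      is_CLCS X Y P (matched_seq X' Y')) /\
  (forall Z : seq T, is_CLCS X Y P Z ->
      (exists X' Y' : seq (option T),
          is_alignment X Y X' Y' /\ occupies_columns Z X' Y') /\
      (forall X' Y' : seq (option T),
          is_alignment X Y X' Y' -> occupies_columns Z X' Y' ->
          is_optimal_CSA (@match_delta T R) X Y P X' Y' /\
          score (@match_delta T R) X' Y' = - (size Z)%:R)).
Proof.
split=> [X' Y' [[al occ] opt] | Z [ZXY PZ maxZ]].
  split; first exact: matched_seq_common al.
    exact/(occupies_columns_matched _ al).
  (* Aligning along a competitor [W] gives a constrained alignment with at least [size W] matches,
     which optimality bounds by those of [X'], [Y']. *)
  move=> W WXY PW; have [U [V [alW occW]]] := common_subseq_alignment WXY.
  have WM := (occupies_columns_matched _ alW).1 occW.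
  have occP : occupies_columns P U V.
    exact/(occupies_columns_matched _ alW)/(subseq_trans PW).
  have := opt U V (conj alW occP).
  rewrite (score_match_delta _ al) (score_match_delta _ alW).
  by rewrite lerN2 ler_nat; apply: leq_trans; exact: size_subseq.
split=> [|X' Y' al occ]; first exact: common_subseq_alignment.
have matched_le U V : is_alignment X Y U V -> occupies_columns P U V ->
    (size (matched_seq U V) <= size Z)%N.
  move=> alU occP; apply: maxZ; first exact: matched_seq_common alU.
  exact/(occupies_columns_matched _ alU).
have ZM := (occupies_columns_matched _ al).1 occ.
have occP : occupies_columns P X' Y'.
  exact/(occupies_columns_matched _ al)/(subseq_trans PZ).
(* [Z] embeds in the matched sequence, which by maximality of [Z] is no longer than [Z]. *)
have scoreZ : score (@match_delta T R) X' Y' = - (size Z)%:R.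
  rewrite (score_match_delta _ al); congr (- _%:R).
  by apply/eqP; rewrite eqn_leq matched_le //= size_subseq.
split=> //; split=> // U V [alU occU].
by rewrite scoreZ (score_match_delta _ alU) lerN2 ler_nat matched_le.
Qed.
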